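(* Consider the system $x(t+1)=f(x(t),u(t))$ with the controllers obtained by solving the RAMPC optimization problems $\mathrm{RAMPC}(j,t)$ of the iterative scheme described in the context, under the stated standing assumptions. Then the iteration cost $$J^j(x_0)=\sum_{i=0}^{L^j-1}h(x^j(i),u^j(i))$$ is non-increasing with the iteration index $j$, i.e. $J^{j}(x_0)\le J^{j-1}(x_0)$ for every iteration $1\le j\le K$.
   Context: **System and sets.** $f:\mathbb R^n\times\mathbb R^m\to\mathbb R^n$, $\mathcal U\subseteq\mathbb R^m$ is the control input set, $\mathcal X=\{x\in\mathbb R^n\mid w(x)\le 0\}$ is the safe set, $\mathcal T=\{x\in\mathbb R^n\mid g(x)\le 0\}\subseteq\mathcal X$ is the target set, $x_0\in\mathcal X\setminus\mathcal T$ is the initial state, and $\mathcal Y=\{f(x,u)\mid x\in\mathcal X,u\in\mathcal U\}\cup\mathcal X$. The stage cost $h$ is continuous with $h(x,u)\ge 0$ for all $(x,u)\in\mathcal X\times\mathcal U$. Fixed parameters: $\lambda\in(1,\infty)$, $M>0$, prediction horizon $N$, maximum iteration number $K$. **Guidance-barrier function.** Given a feedback controller $\hat u:\mathcal X\to\mathcal U$, a bounded function $v:\mathcal Y\to\mathbb R$ is a guidance-barrier function of the system with $\hat u$ if $v(f(x,\hat u(x)))\ge\lambda v(x)$ for all $x\in\mathcal X\setminus\mathcal T$; $v(x)\le 0$ for all $x\in\mathcal Y\setminus\mathcal X$; $v(x)\le M$ for all $x\in\mathcal T$; and $v(x_0)>0$. **Terminal cost.** For a feedback controller $\hat u$, let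 $\pi_{\hat u}$ be the policy applying $\hat u(x(i))$ in state $x(i)$. For a state $x$ from which $\pi_{\hat u}$ drives the system to $\mathcal T$ in finite time while staying in $\mathcal X$ until the first hitting time, $Q(x,\pi_{\hat u})=\sum_{k=0}^{L-1}h(x(k),\hat u(x(k)))$, where $x(0)=x$, $x(k+1)=f(x(k),\hat u(x(k)))$ and $L=\min\{i\in\mathbb N\mid x(i)\in\mathcal T\}$. (With $v$ a guidance-barrier function for $\hat u$, this is the case for every $x\in\mathcal X$ with $v(x)>0$.) **Iterative scheme.** An initial feasible state-control trajectory is given: $x^0(0)=x_0$, $x^0(i+1)=f(x^0(i),u^0(i))$, $u^0(i)\in\mathcal U$, $x^0(i)\in\mathcal X$ for $0\le i\le L^0-1$, and $x^0(L^0)\in\mathcal T$, with $L^0$ the first hitting time of $\mathcal T$. For each $j\ge 0$, from the $j$-th trajectory $\{(x^j(i),u^j(i))\}_{i=0}^{L^j-1}$ one constructs by interpolation a feedback controller $\hat u^j:\mathcal X\to\mathcal U$ with $\hat u^j(x^j(i))=u^j(i)$, $i=0,\dots,L^j-1$, and then a guidance-barrier function $v^j$ of the system with $\hat u^j$. Put $\mathcal R^j=\{x\in\mathcal X\mid v^j(x)>0\}$. For iteration $j\ge1$ and time $t=0,1,2,\dots$, with current state $x_t^j$ ($x_0^j=x_0$), the problem $\mathrm{RAMPC}(j,t)$ is: minimize over $u_{0|t}^j,\dots,u_{N-1|t}^j$ $$\sum_{k=0}^{N-1}h(x_{k|t}^j,u_{k|t}^j)+Q(x_{N|t}^j,\pi_{\hat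 u^{j-1}})$$ subject to $x_{0|t}^j=x_t^j$; $x_{k+1|t}^j=f(x_{k|t}^j,u_{k|t}^j)$, $u_{k|t}^j\in\mathcal U$, $x_{k|t}^j\in\mathcal X$ for $k=0,\dots,N-1$; and the terminal constraint $v^{j-1}(x_{N|t}^j)\ge\lambda^N v^{j-1}(x_0)$ if $t=0$, and $v^{j-1}(x_{N|t}^j)\ge\lambda v^{j-1}(x_{N|t-1}^{j})$ if $t\ge 1$, where $x_{N|t-1}^{j}$ is the terminal state of the optimal solution computed at time $t-1$. Let $\{u_{i|t}^{*,j}\}_{i=0}^{N-1}$, $\{x_{i|t}^{*,j}\}_{i=0}^{N}$ denote an optimal solution of $\mathrm{RAMPC}(j,t)$ (optimal solutions are taken to exist). At time $t$ the input $u^j(t)=u_{0|t}^{*,j}$ is applied, and $x_{t+1}^j=x_{1|t}^{*,j}=f(x_t^j,u^j(t))$. Stopping rule: once there are $t\in\mathbb N$ and $l\le N$ with $x_{l|t}^{*,j}\in\mathcal T$ (take the smallest such $l$ at the first such $t$), no further optimization problems are solved in iteration $j$, and the inputs $u_{0|t}^{*,j},\dots,u_{l-1|t}^{*,j}$ are applied successively from the state $x_{0|t}^{*,j}$. The applied inputs and resulting states form the $j$-th trajectory $\{(x^j(i),u^j(i))\}_{0\le i\le L^j-1}$ with $x^j(L^j)\in\mathcal T$. **Standing assumption.** At each iteration $0\le j\le K$ the set $\mathcal R^j$ is non-empty and contains the state trajectory $\{x^j(i)\}_{i=0}^{L^j-1}$.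
   Formalization: The inequality for iteration j is stated under the added assumption that the prediction horizon N does not exceed the length L^{j-1} of the previous trajectory (and N ≥ 1); without N ≤ L^{j-1} the terminal constraint at t=0 can exclude the previous trajectory and the cost can increase. *)

(* Defs.v *)
(* R^n is 'cV[R]_n over an arbitrary R : realType. *)
From mathcomp Require Import all_boot all_order all_algebra.
From mathcomp Require Import all_classical all_reals all_analysis.
Set Implicit Arguments.
Unset Strict Implicit.
Unset Printing Implicit Defensive.
Import Order.TTheory GRing.Theory Num.Theory.
Import numFieldNormedType.Exports.
Local Open Scope classical_set_scope.
Local Open Scope ring_scope.

Record problem (R : realType) (n m : nat) := Problem {
  dyn : 'cV[R]_n -> 'cV[R]_m -> 'cV[R]_n;           (* f *)
  inputs : set 'cV[R]_m;                            (* U *)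
  safe_fun : 'cV[R]_n -> R;                         (* w *)
  target_fun : 'cV[R]_n -> R;                       (* g *)
  init : 'cV[R]_n;                                  (* x_0 *)
  stage_cost : 'cV[R]_n -> 'cV[R]_m -> R;           (* h *)
  growth : R;                                       (* lambda *)
  level : R;                                        (* M *)
  horizon : nat                                     (* N *)
}.

Definition safe {R n m} (P : problem R n m) : set 'cV[R]_n :=
  [set x | safe_fun P x <= 0].

Definition target {R n m} (P : problem R n m) : set 'cV[R]_n :=
  [set x | target_fun P x <= 0].

(* The set Y. *)
Definition reach {R n m} (P : problem R n m) : set 'cV[R]_n :=
  [set dyn P x u | x in safe P & u in inputs P] `|` safe P.

(* The horizon is positive because the input u_{0|t} is applied at time t. *)
Record problem_ok {R n m} (P : problem R n m) : Prop := ProblemOk {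
  ok_target_safe : target P `<=` safe P;
  ok_init_safe : safe P (init P);
  ok_init_target : ~ target P (init P);
  ok_cost_continuous :
    {within safe P `*` inputs P,
      continuous (fun z : 'cV[R]_n * 'cV[R]_m => stage_cost P z.1 z.2)};
  ok_cost_ge0 : forall x u, safe P x -> inputs P u -> 0 <= stage_cost P x u;
  ok_growth : 1 < growth P;
  ok_level : 0 < level P;
  ok_horizon : (0 < horizon P)%N
}.

(* Controllers X -> U and functions Y -> R are total functions; only their
   values on X, respectively Y, are constrained. *)
Definition feedback {R n m} (P : problem R n m)
    (c : 'cV[R]_n -> 'cV[R]_m) : Prop :=
  forall x, safe P x -> inputs P (c x).

Record guidance_barrier {R n m} (P : problem R n m)
    (c : 'cV[R]_n -> 'cV[R]_m) (v : 'cV[R]_n -> R) : Prop := GuidanceBarrier {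
  gb_bounded : [bounded v x | x in reach P];
  gb_growth : forall x, safe P x -> ~ target P x ->
    growth P * v x <= v (dyn P x (c x));
  gb_unsafe : forall x, reach P x -> ~ safe P x -> v x <= 0;
  gb_target : forall x, target P x -> v x <= level P;
  gb_init : 0 < v (init P)
}.

(* The set R^j of the barrier function v = v^j. *)
Definition reach_avoid {R n m} (P : problem R n m) (v : 'cV[R]_n -> R) :
    set 'cV[R]_n :=
  [set x | safe P x /\ 0 < v x].

Definition first_hit {R n m} (P : problem R n m) (s : nat -> 'cV[R]_n)
    (L : nat) : Prop :=
  target P (s L) /\ forall i, (i < L)%N -> ~ target P (s i).

Definition closed_loop {R n m} (P : problem R n m)
    (c : 'cV[R]_n -> 'cV[R]_m) (x : 'cV[R]_n) (k : nat) : 'cV[R]_n :=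
  iter k (fun y => dyn P y (c y)) x.

(* Q(x, pi_c).  The default 0 of xget is only reached when the closed loop from
   x never hits the target, which cannot happen if x is safe and v x > 0 for a
   guidance-barrier function v of c; in particular it never happens at the
   terminal state of a feasible solution of an optimization problem below. *)
Definition terminal_cost {R n m} (P : problem R n m)
    (c : 'cV[R]_n -> 'cV[R]_m) (x : 'cV[R]_n) : R :=
  let s := closed_loop P c x in
  \sum_(k < xget 0%N [set L | first_hit P s L]) stage_cost P (s k) (c (s k)).

(* A candidate solution is a pair of sequences of which only the states
   xs 0, ..., xs N and the inputs us 0, ..., us (N-1) matter; b is the bound of
   the terminal constraint. *)
Record feasible {R n m} (P : problem R n m) (v : 'cV[R]_n -> R)
    (x : 'cV[R]_n) (b : R)
    (xs : nat -> 'cV[R]_n) (us : nat -> 'cV[R]_m) : Prop := Feasible {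
  feas_start : xs 0%N = x;
  feas_dyn : forall k, (k < horizon P)%N -> xs k.+1 = dyn P (xs k) (us k);
  feas_input : forall k, (k < horizon P)%N -> inputs P (us k);
  feas_safe : forall k, (k < horizon P)%N -> safe P (xs k);
  feas_terminal : b <= v (xs (horizon P))
}.

Definition rampc_cost {R n m} (P : problem R n m) (c : 'cV[R]_n -> 'cV[R]_m)
    (xs : nat -> 'cV[R]_n) (us : nat -> 'cV[R]_m) : R :=
  \sum_(k < horizon P) stage_cost P (xs k) (us k)
    + terminal_cost P c (xs (horizon P)).

Definition optimal {R n m} (P : problem R n m)
    (c : 'cV[R]_n -> 'cV[R]_m) (v : 'cV[R]_n -> R) (x : 'cV[R]_n) (b : R)
    (xs : nat -> 'cV[R]_n) (us : nat -> 'cV[R]_m) : Prop :=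
  feasible P v x b xs us /\
  forall xs' us', feasible P v x b xs' us' ->
    rampc_cost P c xs us <= rampc_cost P c xs' us'.

(* Within one iteration, xo t k = x*_{k|t} and uo t k = u*_{k|t}. *)
Definition current_state {R n m} (P : problem R n m)
    (xo : nat -> nat -> 'cV[R]_n) (t : nat) : 'cV[R]_n :=
  if t is s.+1 then xo s 1%N else init P.

Definition terminal_bound {R n m} (P : problem R n m) (v : 'cV[R]_n -> R)
    (xo : nat -> nat -> 'cV[R]_n) (t : nat) : R :=
  if t is s.+1 then growth P * v (xo s (horizon P))
  else growth P ^+ horizon P * v (init P).

Definition stops {R n m} (P : problem R n m)
    (xo : nat -> nat -> 'cV[R]_n) (t : nat) : Prop :=
  exists2 l, (l <= horizon P)%N & target P (xo t l).

(* Iteration j, with c and v the controller and the barrier function of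
   iteration j-1: optimal solutions are computed up to and including the first
   time at which the stopping rule applies; xo t and uo t are unconstrained at
   later times. *)
Definition rampc_run {R n m} (P : problem R n m)
    (c : 'cV[R]_n -> 'cV[R]_m) (v : 'cV[R]_n -> R)
    (xo : nat -> nat -> 'cV[R]_n) (uo : nat -> nat -> 'cV[R]_m) : Prop :=
  forall t, (forall s, (s < t)%N -> ~ stops P xo s) ->
    optimal P c v (current_state P xo t) (terminal_bound P v xo t)
      (xo t) (uo t).

Definition stopping_pair {R n m} (P : problem R n m)
    (xo : nat -> nat -> 'cV[R]_n) (t l : nat) : Prop :=
  [/\ forall s, (s < t)%N -> ~ stops P xo s,
      (l <= horizon P)%N & first_hit P (xo t) l].

(* The trajectory consists of the states st 0, ..., st len and of the inputs
   inp 0, ..., inp (len-1). *)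
Record trajectory (R : realType) (n m : nat) := Trajectory {
  st : nat -> 'cV[R]_n;
  inp : nat -> 'cV[R]_m;
  len : nat
}.

Record initial_trajectory {R n m} (P : problem R n m)
    (tr : trajectory R n m) : Prop := InitialTrajectory {
  it_start : st tr 0%N = init P;
  it_dyn : forall i, (i < len tr)%N ->
    st tr i.+1 = dyn P (st tr i) (inp tr i);
  it_input : forall i, (i < len tr)%N -> inputs P (inp tr i);
  it_safe : forall i, (i < len tr)%N -> safe P (st tr i);
  it_hit : first_hit P (st tr) (len tr)
}.

(* tr is the trajectory generated by the optimal solutions xo, uo.  That the
   stopping rule eventually applies is not assumed: it follows from the
   terminal constraints, the barrier function being bounded and the growth
   factor larger than 1. *)
Definition applied_trajectory {R n m} (P : problem R n m)
    (xo : nat -> nat -> 'cV[R]_n) (uo : nat -> nat -> 'cV[R]_m)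
    (tr : trajectory R n m) : Prop :=
  forall t l, stopping_pair P xo t l ->
    [/\ len tr = (t + l)%N,
        forall i, (i <= t + l)%N ->
          st tr i = if (i < t)%N then xo i 0%N else xo t (i - t)%N
      & forall i, (i < t + l)%N ->
          inp tr i = if (i < t)%N then uo i 0%N else uo t (i - t)%N].

Definition iteration_cost {R n m} (P : problem R n m)
    (tr : trajectory R n m) : R :=
  \sum_(i < len tr) stage_cost P (st tr i) (inp tr i).

(* Iterations 0, ..., K; xo j and uo j are the optimal solutions computed in
   iteration j >= 1. *)
Record rampc_scheme {R n m} (P : problem R n m) (K : nat)
    (tr : nat -> trajectory R n m)
    (c : nat -> 'cV[R]_n -> 'cV[R]_m) (v : nat -> 'cV[R]_n -> R)
    (xo : nat -> nat -> nat -> 'cV[R]_n)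
    (uo : nat -> nat -> nat -> 'cV[R]_m) : Prop := RampcScheme {
  sch_initial : initial_trajectory P (tr 0%N);
  sch_feedback : forall j, (j <= K)%N -> feedback P (c j);
  sch_interpolation : forall j i, (j <= K)%N -> (i < len (tr j))%N ->
    c j (st (tr j) i) = inp (tr j) i;
  sch_barrier : forall j, (j <= K)%N -> guidance_barrier P (c j) (v j);
  sch_run : forall j, (1 <= j <= K)%N ->
    rampc_run P (c j.-1) (v j.-1) (xo j) (uo j);
  sch_applied : forall j, (1 <= j <= K)%N ->
    applied_trajectory P (xo j) (uo j) (tr j)
}.

Definition standing_assumption {R n m} (P : problem R n m) (K : nat)
    (tr : nat -> trajectory R n m) (v : nat -> 'cV[R]_n -> R) : Prop :=
  forall j, (j <= K)%N ->
    reach_avoid P (v j) !=set0 /\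
    forall i, (i < len (tr j))%N -> reach_avoid P (v j) (st (tr j) i).

(* Main.v *)
(* The previous trajectory, cut after N steps, is feasible for RAMPC(j,0) with
   cost J^{j-1}, because the interpolated controller reproduces the rest of it.
   Shifting the optimal solution at time t and appending one step of that
   controller is feasible at time t+1, so the optimal value drops by at least
   the stage cost applied at time t. Summing up to the stopping time, and
   dropping the nonnegative costs beyond the first hit, bounds J^j by the
   optimal value at time 0. *)
Require Import Defs.
From mathcomp Require Import all_boot all_order all_algebra.
From mathcomp Require Import all_classical all_reals all_analysis.
Import Order.TTheory GRing.Theory Num.Theory.
Local Open Scope ring_scope.

(** * Least indices and unboundedness of geometric sequences *)

Lemma exists_least (Q : nat -> Prop) (i : nat) : Q i ->
  exists k, [/\ (k <= i)%N, Q k & forall l, (l < k)%N -> ~ Q l].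
Proof.
move=> Qi; have exQ : exists k, `[< Q k >] by exists i; apply/asboolP.
case: (ex_minnP exQ) => k /asboolP Qk kmin.
exists k; split=> //; first by apply: kmin; apply/asboolP.
by move=> l lk /asboolP /kmin; rewrite leqNgt lk.
Qed.

Lemma bernoulli (R : realDomainType) (a : R) (i : nat) : 1 <= a ->
  1 + (a - 1) *+ i <= a ^+ i.
Proof.
move=> a1; elim: i => [|i IH]; first by rewrite mulr0n addr0 expr0.
have -> : a ^+ i.+1 = a ^+ i + (a - 1) * a ^+ i.
  by rewrite exprS mulrBl mul1r addrC subrK.
rewrite mulrSr addrA lerD // -[leLHS]mulr1 ler_wpM2l ?subr_ge0 //.
exact: exprn_ege1.
Qed.

Lemma geometric_unbounded (R : archiRealFieldType) (a b M : R) :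
  1 < a -> 0 < b -> exists i, M < a ^+ i * b.
Proof.
move=> a1 b0; have d0 : 0 < (a - 1) * b by rewrite mulr_gt0 ?subr_gt0.
(* Large enough for the linear term of Bernoulli's bound, times [b], to exceed [M]. *)
exists (Num.bound `|M / ((a - 1) * b)|); set i := Num.bound _.
have Mi : M < (a - 1) * b *+ i.
  rewrite -mulr_natl -ltr_pdivrMr //; apply: le_lt_trans (ler_norm _) _.
  exact: archi_boundP (normr_ge0 _).
apply: lt_le_trans Mi _; rewrite -mulrnAl ler_pM2r //.
by apply: le_trans (bernoulli _ _ _ (ltW a1)); rewrite lerDr.
Qed.

(** * Closed loop under a guidance barrier, and its terminal cost *)

Section Barrier.
Context {R : realType} {n m : nat} (P : problem R n m).
Context (c : 'cV[R]_n -> 'cV[R]_m) (v : 'cV[R]_n -> R).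
Hypotheses (hP : problem_ok P) (hc : feedback P c).
Hypothesis (hv : guidance_barrier P c v).

Lemma first_hit_unique (s : nat -> 'cV[R]_n) (k l : nat) :
  first_hit P s k -> first_hit P s l -> k = l.
Proof.
move=> [tk nk] [tl nl]; case: (ltngtP k l) => [kl|lk|->//].
- by case: (nl k kl).
- by case: (nk l lk).
Qed.

Lemma reach_dyn x u : safe P x -> inputs P u -> reach P (dyn P x u).
Proof. by move=> sx iu; left; exists x => //; exists u. Qed.

Lemma barrier_safe x : reach P x -> 0 < v x -> safe P x.
Proof.
move=> rx vx; apply: contrapT => nsx.
by have := gb_unsafe hv rx nsx; rewrite leNgt vx.
Qed.

(** Boundedness of [v] on Y against growth factor above 1. This gives both finite hitting of the
    closed loop and termination of a run. *)
Lemma no_geometric_growth (a : R) (y : nat -> 'cV[R]_n) : 0 < a ->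
  (forall i, reach P (y i)) -> ~ (forall i, growth P ^+ i * a <= v (y i)).
Proof.
move=> a0 ry vy; have [M [_ vM]] := gb_bounded hv.
have [i] := geometric_unbounded _ _ _ (M + 1) (ok_growth hP) a0.
apply/negP; rewrite -leNgt; apply: le_trans (vy i) _.
apply: le_trans (ler_norm _) _.
(* Boundedness is stated as: every constant above [M] bounds the norm of [v]; hence [M + 1]. *)
by apply: (vM (M + 1)); rewrite ?ltrDl // /globally.
Qed.

(** The two claims need a joint induction: growth at a step requires the current state to be safe,
    and the next state, which lies in Y, is safe because [v] is still positive there. *)
Lemma closed_loop_barrier x i : safe P x -> 0 < v x ->
  (forall k, (k < i)%N -> ~ target P (closed_loop P c x k)) ->
  safe P (closed_loop P c x i) /\
  growth P ^+ i * v x <= v (closed_loop P c x i).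
Proof.
move=> sx vx; elim: i => [|i IH] nt; first by rewrite expr0 mul1r.
have {IH} [|si vi] := IH; first by move=> k ki; apply: nt; rewrite ltnW.
have l0 : 0 < growth P := lt_trans ltr01 (ok_growth hP).
have vS : growth P ^+ i.+1 * v x <= v (closed_loop P c x i.+1).
  apply: le_trans (gb_growth hv si (nt i _)) => //.
  by rewrite exprS -mulrA ler_pM2l.
split=> //; apply: barrier_safe; first exact: reach_dyn _ _ si (hc _ si).
by apply: lt_le_trans vS; rewrite mulr_gt0 ?exprn_gt0.
Qed.

Lemma closed_loop_hits x : safe P x -> 0 < v x ->
  exists L, first_hit P (closed_loop P c x) L.
Proof.
move=> sx vx.
have [[i ti]|nt] := pselect (exists i, target P (closed_loop P c x i)).
  by have [L [_ tL nL]] := exists_least (fun i => target P _) i ti; exists L.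
have sv i : safe P (closed_loop P c x i) /\
    growth P ^+ i * v x <= v (closed_loop P c x i).
  by apply: closed_loop_barrier => // k _ tk; apply: nt; exists k.
by case: (no_geometric_growth _ (closed_loop P c x) vx) => i;
  [right; case: (sv i)|case: (sv i)].
Qed.

Lemma terminal_cost_hit x L : first_hit P (closed_loop P c x) L ->
  terminal_cost P c x = \sum_(k < L)
    stage_cost P (closed_loop P c x k) (c (closed_loop P c x k)).
Proof.
move=> hL; rewrite /terminal_cost (xget_unique 0%N hL) // => k hk.
exact: first_hit_unique hk hL.
Qed.

Lemma terminal_cost_ge0 x : safe P x -> 0 < v x -> 0 <= terminal_cost P c x.
Proof.
move=> sx vx; have [L hL] := closed_loop_hits x sx vx.
rewrite (terminal_cost_hit _ _ hL); apply: sumr_ge0 => k _.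
have [|sk _] := closed_loop_barrier x k sx vx; last first.
  exact: (ok_cost_ge0 hP sk (hc _ sk)).
by move=> l lk; apply: hL.2; apply: ltn_trans lk _.
Qed.

(** Bellman identity of the policy: off the target, one closed-loop step lowers the first hitting
    time by one. *)
Lemma terminal_cost_step x : safe P x -> 0 < v x -> ~ target P x ->
  terminal_cost P c x =
    stage_cost P x (c x) + terminal_cost P c (dyn P x (c x)).
Proof.
move=> sx vx ntx; have [[|L] hL] := closed_loop_hits x sx vx.
  by case: ntx; case: hL.
have iterS k : closed_loop P c (dyn P x (c x)) k = closed_loop P c x k.+1.
  by rewrite /closed_loop iterSr.
rewrite (terminal_cost_hit _ _ hL) big_ord_recl (terminal_cost_hit _ L).
  by congr (_ + _); apply: eq_bigr => k _; rewrite iterS.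
by case: hL => tL nL; split=> [|k kL]; rewrite iterS //; apply: nL.
Qed.

(** * Shifting a feasible solution by one time step *)

(** Safety is imposed only up to index N-1, so the terminal state is at first known only to lie in
    Y, as a successor of a safe state. Positivity of [v] later makes it safe. *)
Lemma feasible_reach x b xs us : feasible P v x b xs us ->
  reach P (xs (horizon P)).
Proof.
move=> F; have := ok_horizon hP; case E: (horizon P) => [//|N] _.
have lN : (N < horizon P)%N by rewrite E.
rewrite (feas_dyn F lN); apply: reach_dyn.
- exact: feas_safe F _ lN.
- exact: feas_input F _ lN.
Qed.

(** The barrier growth along the appended step is exactly the next terminal constraint. The costs
    agree with equality because the terminal cost already pays for that step. *)
Lemma feasible_shift x b xs us : 0 < b -> feasible P v x b xs us ->
  ~ target P (xs (horizon P)) ->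
  let xN := xs (horizon P) in
  let xs' k := if (k < horizon P)%N then xs k.+1 else dyn P xN (c xN) in
  let us' k := if (k.+1 < horizon P)%N then us k.+1 else c xN in
  feasible P v (xs 1%N) (growth P * v xN) xs' us' /\
  rampc_cost P c xs us =
    stage_cost P (xs 0%N) (us 0%N) + rampc_cost P c xs' us'.
Proof.
move=> b0 F nt xN xs' us'.
have vN : 0 < v xN := lt_le_trans b0 (feas_terminal F).
have sN : safe P xN := barrier_safe _ (feasible_reach _ _ _ _ F) vN.
have N0 := ok_horizon hP.
have sS k : (k < horizon P)%N -> safe P (xs k.+1).
  rewrite leq_eqVlt => /predU1P[->//|]; exact: (feas_safe F).
split.
  split.
  - by rewrite /xs' N0.
  - move=> k kN; rewrite /xs' /us' kN; case: ltnP => kN1.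
      exact: feas_dyn F _ kN1.
    by have -> : k.+1 = horizon P by apply/eqP; rewrite eqn_leq kN kN1.
  - move=> k kN; rewrite /us'; case: ltnP => kN1.
      exact: feas_input F _ kN1.
    exact: hc.
  - by move=> k kN; rewrite /xs' kN; exact: sS.
  - by rewrite /xs' ltnn; exact: (gb_growth hv sN nt).
have -> : rampc_cost P c xs' us' = \sum_(k < horizon P)
    stage_cost P (xs' k) (us' k) + terminal_cost P c (dyn P xN (c xN)).
  by rewrite /rampc_cost {2}/xs' ltnn.
rewrite /rampc_cost -/xN terminal_cost_step // !addrA; congr (_ + _).
rewrite -(big_mkord xpredT (fun k => stage_cost P (xs k) (us k))).
rewrite -(big_mkord xpredT (fun k => stage_cost P (xs' k) (us' k))).
(* With the horizon written as a successor, the first term of the original sum and the last term of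
   the shifted one are split off; the rest agree up to reindexing. *)
case E : (horizon P) N0 => [//|N] _.
rewrite big_nat_recl // big_nat_recr //= -!addrA; congr (_ + (_ + _)).
  apply: eq_big_nat => k /andP[_ kN].
  by rewrite /xs' /us' E !ltnS kN (ltnW kN).
by rewrite /xs' /us' E ltnSn ltnn -E.
Qed.

(** * Termination and cost descent within one iteration *)

Section Run.
Context (xo : nat -> nat -> 'cV[R]_n) (uo : nat -> nat -> 'cV[R]_m).
Hypothesis (hrun : rampc_run P c v xo uo).

Let unstopped t := forall s, (s < t)%N -> ~ stops P xo s.

(** Each terminal constraint contributes one factor lambda; at time 0 the bound dominates
    [v (init P)] because lambda^N is at least 1. *)
Lemma run_terminal_bound t : unstopped t ->
  growth P ^+ t * v (init P) <= terminal_bound P v xo t.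
Proof.
have l1 := ok_growth hP; have l0 : 0 < growth P := lt_trans ltr01 l1.
have v0 := gb_init hv.
elim: t => [_|t IH U] /=.
  by rewrite expr0 ler_pM2r // exprn_ege1 // ltW.
have Ut : unstopped t by move=> s st; apply: U; rewrite ltnW.
rewrite exprS -mulrA ler_pM2l //; apply: le_trans (IH Ut) _.
exact: feas_terminal (hrun t Ut).1.
Qed.

Lemma terminal_bound_gt0 t : unstopped t -> 0 < terminal_bound P v xo t.
Proof.
move=> /run_terminal_bound; apply: lt_le_trans.
by rewrite mulr_gt0 ?(gb_init hv) ?exprn_gt0 ?(lt_trans ltr01 (ok_growth hP)).
Qed.

(** Otherwise all problems are solved, and [v] grows geometrically along the predicted terminal
    states, which lie in Y. *)
Lemma run_stops : exists t l, stopping_pair P xo t l.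
Proof.
have [[t St]|nS] := pselect (exists t, stops P xo t).
  have [k [_ [l lN tl] U]] := exists_least (stops P xo) t St.
  have [i [il ti ni]] := exists_least (fun i => target P (xo k i)) l tl.
  by exists k, i; split=> //; apply: leq_trans il lN.
have U t : unstopped t by move=> s _ Ss; apply: nS; exists s.
case: (no_geometric_growth _ (fun t => xo t (horizon P)) (gb_init hv)) => t.
  exact: feasible_reach (hrun t (U t)).1.
exact: le_trans (run_terminal_bound t (U t)) (feas_terminal (hrun t (U t)).1).
Qed.

Lemma rampc_cost_descent t : unstopped t.+1 ->
  stage_cost P (xo t 0%N) (uo t 0%N) + rampc_cost P c (xo t.+1) (uo t.+1)
    <= rampc_cost P c (xo t) (uo t).
Proof.
move=> U; have Ut : unstopped t by move=> s st; apply: U; rewrite ltnW.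
have [|F ->] := feasible_shift _ _ _ _ (terminal_bound_gt0 t Ut) (hrun t Ut).1.
  (* The stopping test includes l = N, so the terminal state at an unstopped time is off target. *)
  by move=> tN; apply: (U t) => //; exists (horizon P).
by rewrite lerD2l; apply: (hrun t.+1 U).2.
Qed.

Lemma rampc_cost_sum t : unstopped t ->
  \sum_(i < t) stage_cost P (xo i 0%N) (uo i 0%N)
    + rampc_cost P c (xo t) (uo t) <= rampc_cost P c (xo 0%N) (uo 0%N).
Proof.
elim: t => [_|t IH U]; first by rewrite big_ord0 add0r.
have Ut : unstopped t by move=> s st; apply: U; rewrite ltnW.
apply: le_trans (IH Ut); rewrite big_ord_recr /= -addrA lerD2l.
exact: rampc_cost_descent.
Qed.

Lemma rampc_cost_ge_prefix t l : unstopped t -> (l <= horizon P)%N ->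
  \sum_(k < l) stage_cost P (xo t k) (uo t k) <= rampc_cost P c (xo t) (uo t).
Proof.
move=> U lN; have F := (hrun t U).1.
have vN := lt_le_trans (terminal_bound_gt0 t U) (feas_terminal F).
have sN := barrier_safe _ (feasible_reach _ _ _ _ F) vN.
rewrite -[leLHS]addr0; apply: lerD; last exact: terminal_cost_ge0.
rewrite -(big_mkord xpredT (fun k => stage_cost P (xo t k) (uo t k))).
rewrite -(big_mkord xpredT (fun k => stage_cost P (xo t k) (uo t k))).
rewrite (big_cat_nat (leq0n l) lN) //= lerDl big_nat_cond; apply: sumr_ge0 => k.
rewrite andbT => /andP[_ kN]; apply: ok_cost_ge0 => //.
- exact: feas_safe F _ kN.
- exact: feas_input F _ kN.
Qed.

(** * The trajectory applied in one iteration *)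

Context (tr : trajectory R n m).
Hypothesis (htr : applied_trajectory P xo uo tr).

(** This lets a generated trajectory take the place of the initial one as a candidate in the next
    iteration. *)
Lemma applied_initial_trajectory : initial_trajectory P tr.
Proof.
have [t [l S]] := run_stops; have [U lN [tl nl]] := S.
have [Lt sE iE] := htr t l S.
have Us s : (s <= t)%N -> unstopped s.
  by move=> st r rs; apply: U; apply: leq_trans rs st.
have F s : (s <= t)%N -> feasible P v (current_state P xo s)
    (terminal_bound P v xo s) (xo s) (uo s).
  by move=> st; exact: (hrun s (Us s st)).1.
have N0 := ok_horizon hP.
have tail i : (i < t + l)%N -> (t <= i)%N -> (i - t < horizon P)%N.
  by move=> il ti; apply: leq_trans lN; rewrite ltn_subLR.
split; rewrite ?Lt.
- rewrite sE // sub0n.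
  by case: posnP => [->|_]; exact: feas_start (F 0%N (leq0n t)).
- move=> i il; rewrite (sE _ il) (sE _ (ltnW il)) (iE _ il).
  case: (ltnP i t) => it; last first.
    by rewrite ltnNge leqW //= subSn // (feas_dyn (F t _)) // tail.
  have E : xo i.+1 0%N = dyn P (xo i 0%N) (uo i 0%N).
    by rewrite (feas_start (F i.+1 _)) //= (feas_dyn (F i _)) // ltnW.
  (* At the seam [i.+1 = t] the state is read from the last solution at offset 0. *)
  case: ltnP => // ti; have -> : t = i.+1 by apply/eqP; rewrite eqn_leq ti it.
  by rewrite subnn.
- move=> i il; rewrite iE //; case: ltnP => it.
    by apply: feas_input (F i _) _ _ => //; rewrite ltnW.
  by apply: feas_input (F t _) _ _ => //; apply: tail.
- move=> i il; rewrite (sE _ (ltnW il)); case: ltnP => it.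
    by apply: feas_safe (F i _) _ _ => //; rewrite ltnW.
  by apply: feas_safe (F t _) _ _ => //; apply: tail.
split; first by rewrite sE // ltnNge leq_addr /= addKn.
move=> i il; rewrite (sE _ (ltnW il)); case: ltnP => it.
  (* A target state before time [t] would trigger the stopping rule with l = 0. *)
  by move=> ti; apply: (U i it); exists 0%N.
by apply: nl; rewrite ltn_subLR.
Qed.

Lemma iteration_cost_le_rampc_cost :
  iteration_cost P tr <= rampc_cost P c (xo 0%N) (uo 0%N).
Proof.
have [t [l S]] := run_stops; have [U lN _] := S.
have [Lt sE iE] := htr t l S.
apply: le_trans (rampc_cost_sum t U); rewrite /iteration_cost Lt.
(* Cut at the stopping time: one stage cost per solved problem before it, a prefix of the last
   optimal solution after it. *)
rewrite big_split_ord /=.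
apply: lerD.
  apply: ler_sum => i _; have il : (i < t + l)%N by rewrite ltn_addr.
  by rewrite (sE _ (ltnW il)) (iE _ il) ltn_ord.
apply: le_trans (rampc_cost_ge_prefix t l U lN); apply: ler_sum => i _.
have il : (t + i < t + l)%N by rewrite ltn_add2l.
by rewrite (sE _ (ltnW il)) (iE _ il) ltnNge leq_addr /= addKn.
Qed.

End Run.

(** * The previous trajectory as a candidate at time 0 *)

Lemma rampc_cost_le_iteration_cost (tr : trajectory R n m) xo uo :
  initial_trajectory P tr ->
  (forall i, (i < len tr)%N -> c (st tr i) = inp tr i) ->
  (horizon P <= len tr)%N -> rampc_run P c v xo uo ->
  rampc_cost P c (xo 0%N) (uo 0%N) <= iteration_cost P tr.
Proof.
move=> T cE NL hrun; have [tL nL] := it_hit T.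
have loopE i k : (i + k <= len tr)%N ->
    closed_loop P c (st tr i) k = st tr (i + k)%N.
  elim: k => [|k IH] ik; first by rewrite addn0.
  rewrite addnS in ik *; rewrite (it_dyn T ik) /closed_loop iterS.
  by rewrite -/(closed_loop P c _ k) IH 1?ltnW // cE.
have lastE : (horizon P + (len tr - horizon P) = len tr)%N by rewrite subnKC.
(* What remains after N steps is the closed loop up to the same hit; if N equals [len tr], it is
   empty and the terminal cost is 0. *)
have hit : first_hit P (closed_loop P c (st tr (horizon P)))
    (len tr - horizon P).
  split=> [|k kL]; first by rewrite loopE lastE.
  by rewrite loopE -?ltn_subRL ?(ltnW kL) //;
    [apply: nL; rewrite -ltn_subRL|rewrite -lastE leq_add2l ltnW].
have F : feasible P v (init P) (growth P ^+ horizon P * v (init P))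
    (st tr) (inp tr).
  split=> [|k kN|k kN|k kN|]; first exact: it_start T.
  - exact: it_dyn T _ (leq_trans kN NL).
  - exact: it_input T _ (leq_trans kN NL).
  - exact: it_safe T _ (leq_trans kN NL).
  (* The first N steps are also a closed loop of [c], off target before index N, so [v] gains the
     factor lambda^N demanded at time 0. *)
  have [|_] := closed_loop_barrier (init P) (horizon P)
    (ok_init_safe hP) (gb_init hv).
    move=> k kN; have kL := leq_trans kN NL.
    by rewrite -(it_start T) loopE ?add0n //; [exact: nL|rewrite ltnW].
  by rewrite -{2}(it_start T) loopE.
have [//|_ /(_ _ _ F) opt] := hrun 0%N; apply: le_trans opt _.
rewrite /rampc_cost (terminal_cost_hit _ _ hit) /iteration_cost.
rewrite -[in leRHS]lastE big_split_ord /= lerD2l; apply: ler_sum => k _.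
have kL : (horizon P + k < len tr)%N by rewrite -ltn_subRL.
by rewrite loopE 1?ltnW // cE.
Qed.

End Barrier.

Theorem theorem3 (R : realType) (n m : nat) (P : problem R n m) (K : nat)
    (tr : nat -> trajectory R n m)
    (c : nat -> 'cV[R]_n -> 'cV[R]_m) (v : nat -> 'cV[R]_n -> R)
    (xo : nat -> nat -> nat -> 'cV[R]_n)
    (uo : nat -> nat -> nat -> 'cV[R]_m)
    (hP : problem_ok P)
    (hscheme : rampc_scheme P K tr c v xo uo)
    (hstanding : standing_assumption P K tr v)
    (j : nat) (hj : (1 <= j <= K)%N)
    (hN : (horizon P <= len (tr j.-1))%N) :
  iteration_cost P (tr j) <= iteration_cost P (tr j.-1).
Proof.
case: hscheme => init0 fb interp gb run app.
have jK i : (i < j)%N -> (i <= K)%N.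
  by case/andP: hj => _ jK ij; apply: leq_trans (ltnW ij) jK.
case: j hj hN jK => [//|i] hj hN jK; rewrite /= in hN *.
(* A case distinction replaces induction: a generated trajectory is admissible by its own run and
   the barrier used in it. *)
have init_i : initial_trajectory P (tr i).
  case: i {hN} hj jK => [//|i] hj jK.
  have hi : (1 <= i.+1 <= K)%N by rewrite jK.
  have iK : (i <= K)%N by apply: jK; rewrite leqW.
  exact: (applied_initial_trajectory P _ _ hP (gb i iK) _ _
    (run _ hi) _ (app _ hi)).
have iK : (i <= K)%N by apply: jK.
apply: le_trans (iteration_cost_le_rampc_cost P _ _ hP (fb i iK) (gb i iK) _ _
  (run _ hj) _ (app _ hj)) _.
apply: (rampc_cost_le_iteration_cost P _ _ hP (fb i iK) (gb i iK)) => //.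
- by move=> k kL; apply: interp.
- exact: run _ hj.
Qed.
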